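(* Suppose that $(M,g)$ satisfies the condition (G) if $x_1, x_2 \in M$ and $r_{x_1} \le r_{x_2}$ (pointwise on $\partial M$), then $x_1 = x_2$. Then $R(M)$ is the set of maximal elements of $\overline{Q(M)}$, where $\overline{Q(M)}$ is the closure of $Q(M)$ in $C(\partial M)$.
   Context: $(M,g)$ is a $C^\infty$-smooth, compact and connected Riemannian manifold of dimension $n\ge 2$ with nonempty boundary $\partial M$ and Riemannian distance $d$. $\mu$ is a $C^\infty$-smooth strictly positive function on $M$ and $m$ is the measure on $M$ given by $dm = \mu\,dV_g$, where $V_g$ is the Riemannian volume measure ($dm=\mu|g|^{1/2}dx$ in coordinates). $C(\partial M)$ is the space of real valued continuous functions on $\partial M$ with the sup norm topology, partially ordered by $\tau\le\sigma$ iff $\tau(y)\le\sigma(y)$ for all $y\in\partial M$. For $\tau\in C(\partial M)$, $$M(\partial M,\tau) = \{x\in M: \text{there is } y\in\partial M \text{ such that } d(x,y)\le\tau(y)\},\qquad m_\tau = m(M(\partial M,\tau)),\qquad m_\infty = m(M).$$ For $x\in M$, the boundary distance function $r_x:\partial M\to[0,\infty)$ is $r_x(y)=d(x,y)$. Define $$Q(M) = \{\tau\in C(\partial M) : m_\tau<m_\infty\},\qquad R(M)=\{r_x\in C(\partial M) : x\in M\}.$$ An element $\tau$ of a set $A \subset C(\partial M)$ is maximal if $\sigma\in A$ and $\tau\le\sigma$ imply $\sigma=\tau$. *)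

(* Defs.v *)
From HB Require Import structures.
From mathcomp Require Import all_boot all_order all_algebra.
From mathcomp Require Import all_classical all_reals all_analysis.

Set Implicit Arguments.
Unset Strict Implicit.
Unset Printing Implicit Defensive.

Import Order.TTheory GRing.Theory Num.Theory.
Import numFieldNormedType.Exports.

Local Open Scope classical_set_scope.
Local Open Scope ring_scope.

Section lebesgue_tuple_step.
Context {R : realType} {n : nat}.
Variable nu : {sigma_finite_measure set (n.-tuple R) -> \bar R}.

Let cons_pair (p : R * n.-tuple R) : n.+1.-tuple R := [the _.-tuple R of p.1 :: p.2].

Let measurable_cons_pair : measurable_fun [set: R * n.-tuple R] cons_pair.
Proof. by apply: measurable_cons; [exact: measurable_fst|exact: measurable_snd]. Qed.

Definition lebesgue_tuple_step : set (n.+1.-tuple R) -> \bar R :=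
  pushforward (@lebesgue_measure R \x nu)%E cons_pair.

Let step0 : lebesgue_tuple_step set0 = 0%E.
Proof. by rewrite /lebesgue_tuple_step /pushforward preimage_set0 measure0. Qed.

Let step_ge0 A : (0 <= lebesgue_tuple_step A)%E.
Proof. exact: measure_ge0. Qed.

Let step_sigma_additive : semi_sigma_additive lebesgue_tuple_step.
Proof.
move=> F mF tF mUF; rewrite /lebesgue_tuple_step /pushforward preimage_bigcup.
apply: measure_semi_sigma_additive.
- by move=> k; rewrite -[X in measurable X]setTI; exact: measurable_cons_pair.
- apply/trivIsetP => i j _ _ ij; rewrite -preimage_setI.
  by move/trivIsetP : tF => /(_ _ _ _ _ ij) ->//; rewrite preimage_set0.
- rewrite -preimage_bigcup -[X in measurable X]setTI.
  exact: measurable_cons_pair.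
Qed.

HB.instance Definition _ := isMeasure.Build _ _ _ lebesgue_tuple_step
  step0 step_ge0 step_sigma_additive.

Let step_sigma_finite : sigma_finite setT lebesgue_tuple_step.
Proof.
have /sigma_finiteP[G [TG ndG Goo]] := sigma_finiteT (@lebesgue_measure R).
have /sigma_finiteP[H [TH ndH Hoo]] := sigma_finiteT nu.
have [F TF Foo] : sigma_finite setT (@lebesgue_measure R \x nu)%E.
  exists (fun k => G k `*` H k).
    rewrite -setXTT TG TH predeqE => -[x y]; split.
      move=> [/= [k _ Gkx] [l _ Hly]]; exists (maxn k l) => //; split.
      - by move: x Gkx; exact/subsetPset/ndG/leq_maxl.
      - by move: y Hly; exact/subsetPset/ndH/leq_maxr.
    by move=> [k _ []/= ? ?]; split; exists k.
  move=> k; have [? ?] := Goo k; have [? ?] := Hoo k.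
  split; first exact: measurableX.
  by rewrite product_measure1E// lte_mul_pinfty// ge0_fin_numE.
pose u (t : n.+1.-tuple R) : R * n.-tuple R := (thead t, [tuple of behead t]).
have mu_ : measurable_fun setT u.
  apply/measurable_fun_pairP; split; first exact: measurable_tnth.
  exact: measurable_behead.
have cK : cancel cons_pair u.
  by move=> [x t]; rewrite /u /cons_pair; congr pair; apply/val_inj.
exists (fun k => u @^-1` (F k)).
  by rewrite -preimage_bigcup -TF preimage_setT.
move=> k; have [mFk Fk] := Foo k; split.
  by rewrite -[X in measurable X]setTI; exact: mu_.
rewrite /lebesgue_tuple_step /pushforward -comp_preimage.
suff -> : u \o cons_pair = id by [].
by apply/funext => p; exact: cK.
Qed.

HB.instance Definition _ := Measure_isSigmaFinite.Build _ _ _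
  lebesgue_tuple_step step_sigma_finite.

End lebesgue_tuple_step.

(* Lebesgue measure on the Borel sets of R^n, by iterated products. *)
Fixpoint lebesgue_tuple (R : realType) (n : nat) :
    {sigma_finite_measure set (n.-tuple R) -> \bar R} :=
  match n with
  | 0 => \d_([tuple] : 0.-tuple R)
  | n'.+1 => lebesgue_tuple_step (lebesgue_tuple R n')
  end.

Section smooth_maps.
Context {R : realType} {n : nat} {W : normedModType R}.
Implicit Types (U A : set 'rV[R]_n) (f F : 'rV[R]_n -> W).

Definition partial (i : 'I_n) f (x : 'rV[R]_n) : W :=
  'D_(delta_mx ord0 i) f x.

Fixpoint Ck (k : nat) U f : Prop :=
  (forall x, U x -> {for x, continuous f}) /\
  match k with
  | 0 => True
  | k'.+1 => forall i : 'I_n,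
      (forall x, U x -> derivable f x (delta_mx ord0 i)) /\
      Ck k' U (partial i f)
  end.

Definition Cinfty U f : Prop := forall k, Ck k U f.

Definition smooth_extension A f (x : 'rV[R]_n) U F : Prop :=
  [/\ open U, U x, Cinfty U F & forall v, U v -> A v -> F v = f v].

(* [A] need not be open: smoothness on a subset of a half-space is local
   extendability to a smooth map on an open subset of R^n. *)
Definition smooth_on A f : Prop :=
  forall x, A x -> exists U F, smooth_extension A f x U F.

End smooth_maps.

(* [n] is not of the form [_.+1], hence the quantification over indices equal
   to 0. *)
Definition half_space (R : realType) (n : nat) : set 'rV[R]_n :=
  [set v | forall i : 'I_n, i = 0%N :> nat -> 0 <= v ord0 i].

Record chart (R : realType) (n : nat) (M : topologicalType) := Chart {
  chart_dom : set M;
  chart_map :> M -> 'rV[R]_n;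
  chart_inv : 'rV[R]_n -> M;
  chart_img := chart_map @` chart_dom;
  chart_dom_open : open chart_dom;
  chart_img_open : exists U : set 'rV[R]_n,
    open U /\ chart_img = U `&` @half_space R n;
  chart_mapK : {in chart_dom, cancel chart_map chart_inv};
  chart_map_continuous : {within chart_dom, continuous chart_map};
  chart_inv_continuous : {within chart_img, continuous chart_inv}
}.

Definition transition (R : realType) n (M : topologicalType)
    (phi psi : chart R n M) : 'rV[R]_n -> 'rV[R]_n :=
  fun v => psi (chart_inv phi v).

Definition transition_dom (R : realType) n (M : topologicalType)
    (phi psi : chart R n M) : set 'rV[R]_n :=
  phi @` (chart_dom phi `&` chart_dom psi).

Record smooth_atlas (R : realType) (n : nat) (M : topologicalType) :=
  SmoothAtlas {
    charts : set (chart R n M);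
    charts_cover : forall p : M, exists2 phi, charts phi & chart_dom phi p;
    charts_compatible : forall phi psi, charts phi -> charts psi ->
      smooth_on (transition_dom phi psi) (transition phi psi)
  }.

Section manifold.
Context {R : realType} {n : nat} {M : topologicalType}.
Variable S : smooth_atlas R n M.

Definition mboundary : set M :=
  [set p | exists2 phi, charts S phi & chart_dom phi p /\
           exists2 i : 'I_n, i = 0%N :> nat & phi p ord0 i = 0].

Definition smooth_function (f : M -> R) : Prop :=
  forall phi, charts S phi -> smooth_on (chart_img phi) (f \o chart_inv phi : _ -> R^o).

(* [gcoef phi v] is the matrix of the metric in the chart [phi] at the point of
   coordinates [v]. Vectors are rows and 'J F v acts on them on the right,
   whence the form of the change of chart law; at boundary points the derivative
   of the transition map is that of any of its smooth extensions. *)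
Record riemannian_metric := RiemannianMetric {
  gcoef :> chart R n M -> 'rV[R]_n -> 'M[R]_n;
  gcoef_smooth : forall phi, charts S phi -> smooth_on (chart_img phi) (gcoef phi);
  gcoef_sym : forall phi v, charts S phi -> chart_img phi v ->
    (gcoef phi v)^T = gcoef phi v;
  gcoef_pos : forall phi v, charts S phi -> chart_img phi v ->
    forall w : 'rV[R]_n, w != 0 -> 0 < (w *m gcoef phi v *m w^T) ord0 ord0;
  gcoef_transition : forall phi psi v, charts S phi -> charts S psi ->
    transition_dom phi psi v ->
    forall U F,
    smooth_extension (transition_dom phi psi) (transition phi psi) v U F ->
    gcoef phi v = 'J F v *m gcoef psi (transition phi psi v) *m ('J F v)^T
}.

Variable g : riemannian_metric.

Definition C1_curve (c : R -> 'rV[R]_n) : Prop :=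
  (forall t, derivable c t 1) /\ continuous (derive1 c).

Definition speed (phi : chart R n M) (c : R -> 'rV[R]_n) (t : R) : R :=
  Num.sqrt ((derive1 c t *m g phi (c t) *m (derive1 c t)^T) ord0 ord0).

(* The curve [gamma] on [a, b] is piecewise C^1 and has length [L]: on each
   interval of a subdivision [t], it stays in a chart where it is represented
   by (the restriction of) a C^1 map [c i] from R to R^n. *)
Definition curve_has_length (gamma : R -> M) (a b L : R) : Prop :=
  exists (N : nat) (t : nat -> R) (phi : nat -> chart R n M)
         (c : nat -> R -> 'rV[R]_n),
    [/\ t 0%N = a, t N = b,
        forall i, (i < N)%N ->
          [/\ t i < t i.+1, charts S (phi i), C1_curve (c i) &
              forall s, s \in `[t i, t i.+1] ->
                chart_dom (phi i) (gamma s) /\ c i s = phi i (gamma s)] &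
        L = \sum_(i < N)
              \int[lebesgue_measure]_(s in `[t i, t i.+1]) speed (phi i) (c i) s].

Definition riem_dist (x y : M) : R :=
  inf [set L | exists gamma a b,
         [/\ gamma a = x, gamma b = y & curve_has_length gamma a b L]].

End manifold.

Definition borel (M : ptopologicalType) := g_sigma_algebraType (@open M).

Definition row_of_tuple (R : realType) n (t : n.-tuple R) : 'rV[R]_n :=
  \row_i tnth t i.

(* Since the charts cover the compact space M, this determines V uniquely. *)
Definition is_riemannian_volume (R : realType) n (M : ptopologicalType)
    (S : smooth_atlas R n M) (g : riemannian_metric S)
    (V : {measure set (borel M) -> \bar R}) : Prop :=
  forall (phi : chart R n M) (A : set (borel M)),
    charts S phi -> measurable A -> A `<=` chart_dom phi ->
    V A = (\int[lebesgue_tuple R n]_(t in [set t | (phi @` A) (row_of_tuple t)])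
             (Num.sqrt (\det (g phi (row_of_tuple t))))%:E)%E.

Definition weighted_measure (R : realType) (M : ptopologicalType)
    (V : {measure set (borel M) -> \bar R}) (mu : M -> R) (A : set M) : \bar R :=
  (\int[V]_(x in A) (mu x)%:E)%E.

Section boundary_functions.
Import ArrowAsUniformType.
Context {R : realType} {n : nat} {M : ptopologicalType}.
Context {S : smooth_atlas R n M} (g : riemannian_metric S).

Let bd : Type := set_type (mboundary S).
Let C := continuousType bd R.

Definition bdist (x : M) : bd -> R := fun y => riem_dist g x (\val y).

Definition Mset (tau : bd -> R) : set M :=
  [set x | exists y : bd, riem_dist g x (\val y) <= tau y].

Definition Qset (V : {measure set (borel M) -> \bar R}) (mu : M -> R) : set C :=
  [set tau | (weighted_measure V mu (Mset tau) <
              weighted_measure V mu [set: M])%E].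

Definition Rset : set C := [set tau | exists x : M, (tau : bd -> R) = bdist x].

(* The instance found by [closure] is the topology of uniform convergence, i.e.
   of the sup norm, as imported from [ArrowAsUniformType]. *)
Definition uclosure (A : set C) : set C := closure A.

Definition maximal_elements (A : set C) : set C :=
  [set tau | A tau /\
     forall sigma, A sigma -> (forall y, tau y <= sigma y) -> sigma = tau].

End boundary_functions.

(* Main.v *)
(** If [d(z,x) < e], the triangle inequality gives [r_x(y) - e < d(z,y)] for all
boundary points [y], so [M(bd M, r_x - e)] misses a ball around [x]; as nonempty
open sets have positive measure and [m(M)] is finite, [r_x - e] lies in [Q(M)]
and [r_x] in its closure. Conversely [m_tau < m_oo] yields a point outside
[M(bd M, tau)], hence [tau < r_x] for some [x]; by compactness of [M] every
[tau] in the closure of [Q(M)] still satisfies [tau <= r_x] for some [x]. So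
the maximal elements of the closure are among the [r_x], and (G) makes each
[r_x] maximal.

The distance enters only through its continuity, obtained by prolonging curves
with short straight segments of a chart. *)
Require Import Defs.
From mathcomp Require Import all_boot all_order all_algebra.
From mathcomp Require Import ring lra.
From mathcomp Require Import all_classical all_reals all_analysis.
Import Order.TTheory GRing.Theory Num.Theory.
Import numFieldNormedType.Exports.
Local Open Scope classical_set_scope.
Local Open Scope ring_scope.

Set Implicit Arguments.
Unset Strict Implicit.
Unset Printing Implicit Defensive.

(** * Estimates of integrals and of quadratic forms *)

(* No measurability is assumed: the integral of a nonnegative function is by
   definition a supremum over the simple functions below it. *)
Lemma ge0_le_integral_dom {d} {T : measurableType d} {R : realType}
    (m : {measure set T -> \bar R}) (D D' : set T) (f f' : T -> \bar R) :
  (forall x, D x -> 0 <= f x)%E -> (forall x, D' x -> 0 <= f' x)%E ->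
  (forall x, D x -> D' x /\ (f x <= f' x)%E) ->
  (\int[m]_(x in D) f x <= \int[m]_(x in D') f' x)%E.
Proof.
move=> f0 f'0 ff'; rewrite ge0_integralE// ge0_integralE//.
apply: ereal_sup_le => _ [h hf <-]; exists h => // x; apply: le_trans (hf x) _.
rewrite /patch; case: ifPn => [/set_mem Dx|_].
  by have [D'x ?] := ff' _ Dx; rewrite mem_set.
by case: ifPn => // /set_mem; exact: f'0.
Qed.

Lemma Rintegral_le_cst {R : realType} (f : R -> R) (a b K : R) :
  a <= b -> (forall s, s \in `[a, b] -> 0 <= f s <= K) ->
  \int[lebesgue_measure]_(s in `[a, b]) f s <= K * (b - a).
Proof.
move=> ab fK; have K0 : 0 <= K.
  by have /andP[/le_trans] := fK a ltac:(by rewrite bound_itvE); apply.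
have f0 s : s \in `[a, b] -> (0 <= (f s)%:E)%E.
  by move=> /fK /andP[]; rewrite lee_fin.
rewrite /Rintegral -[leRHS]/(fine (K * (b - a))%:E).
(* The extended-valued bound comes first: it also gives the finiteness under which [fine] is
   monotone. *)
have le1 : (\int[lebesgue_measure]_(s in `[a, b]) (f s)%:E <= (K * (b - a))%:E)%E.
  apply: (@le_trans _ _ (\int[lebesgue_measure]_(s in `[a, b]) (cst K%:E s))%E).
    apply: ge0_le_integral_dom => s /=; rewrite ?lee_fin// => sab.
    - by have /andP[] := fK s sab.
    - by split=> //; have /andP[] := fK s sab.
  rewrite integral_cst//= lebesgue_measure_itv/= lte_fin.
  case: ltP => [_|ba]; first by rewrite -EFinD -EFinM.
  by rewrite mule0 lee_fin mulr_ge0// subr_ge0.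
apply: fine_le => //.
rewrite ge0_fin_numE; first exact: le_lt_trans le1 (ltry _).
exact: integral_ge0.
Qed.

Lemma le_coord_norm {R : realType} {m n} (A : 'M[R]_(m, n)) i j :
  `|A i j| <= `|A|.
Proof.
by rewrite [leRHS]/Num.norm /= mx_normrE; apply/bigmax_geP; right; exists (i, j).
Qed.

(** The norm of a matrix is the largest absolute value of its entries, so each of the [n ^ 2] terms
    of the quadratic form is at most [|G| |v| ^ 2]. *)
Lemma mulmx_quad_le {R : realType} {n} (G : 'M[R]_n) (v : 'rV[R]_n) :
  (v *m G *m v^T) ord0 ord0 <= `|G| * (n%:R * `|v|) ^+ 2.
Proof.
apply: le_trans (ler_norm _) _; rewrite mxE.
apply: (le_trans (ler_norm_sum _ _ _)).
apply: (@le_trans _ _ (\sum_(j < n) (n%:R * (`|v| * `|G|)) * `|v|)); last first.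
  rewrite sumr_const card_ord -mulr_natl le_eqVlt; apply/orP; left.
  by apply/eqP; ring.
apply: ler_sum => j _; rewrite mxE normrM ler_pM//; last first.
  by rewrite mxE le_coord_norm.
apply: (le_trans (ler_norm_sum _ _ _)).
have -> : n%:R * (`|v| * `|G|) = \sum_(i < n) (`|v| * `|G|).
  by rewrite sumr_const card_ord mulr_natl.
apply: ler_sum => i _.
by rewrite normrM ler_pM// le_coord_norm.
Qed.

Lemma C1_curve_segment {R : realType} {n} (p v : 'rV[R]_n) (a : R) :
  C1_curve (fun s => p + (s - a) *: v) /\
  derive1 (fun s => p + (s - a) *: v) = cst v.
Proof.
set c := fun s => _.
have qt t : (fun h => h^-1 *: (c (h *: 1 + t) - c t)) @ (0 : R)^' --> v.
  apply: cvg_near_cst; near=> h.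
  have h0 : h != 0 by near: h; exact: nbhs_dnbhs_neq.
  rewrite /c [h *: 1]mulr1 opprD addrACA subrr add0r -scalerBl.
  have -> : h + t - a - (t - a) = h by ring.
  by rewrite scalerA mulVf ?scale1r.
have dE : derive1 c = cst v.
  apply/funext => t; rewrite derive1E /derive; apply/cvg_lim; last exact: (qt t).
  exact: norm_hausdorff.
split => //; split=> [t|]; first by apply/cvg_ex; exists v; exact: qt.
by rewrite dE; move=> t; exact: cvg_cst.
Unshelve. all: by end_near. Qed.

(** * Limits in charts, up to the boundary *)

Lemma smooth_on_cvg {R : realType} {n} {W : normedModType R}
    (A : set 'rV[R]_n) (f : 'rV[R]_n -> W) (p : 'rV[R]_n) :
  smooth_on A f -> A p -> f @ within A (nbhs p) --> f p.
Proof.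
move=> sf Ap; have [U [F [Uo Up /(_ 0%N)[Fc _] FE]]] := sf p Ap.
rewrite -(FE _ Up Ap) => B /(Fc p Up) FB.
change (\forall v \near p, A v -> B (f v)); near=> v => Av.
have Uv : U v by near: v; exact: open_nbhs_nbhs.
by rewrite -(FE _ Uv Av); near: v.
Unshelve. all: by end_near. Qed.

Section charts.
Context {R : realType} {n : nat} {M : topologicalType}.
Implicit Types (phi : chart R n M) (x z : M).

Lemma chart_dom_nbhs phi x : chart_dom phi x -> nbhs x (chart_dom phi).
Proof. by move=> px; apply: open_nbhs_nbhs; split=> //; exact: chart_dom_open. Qed.

Lemma chart_imgT phi x : chart_dom phi x -> chart_img phi (phi x).
Proof. by move=> px; exists x. Qed.

Lemma chart_cvg phi x : chart_dom phi x -> phi z @[z --> x] --> phi x.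
Proof.
move=> px; have := @chart_map_continuous _ _ _ phi.
rewrite continuous_open_subspace; last exact: chart_dom_open.
by apply; rewrite inE.
Qed.

(** The metric coefficients and [chart_inv] only have limits along [within (chart_img phi)]; this
    form of continuity composes with them. *)
Lemma chart_cvg_img phi x : chart_dom phi x ->
  phi z @[z --> x] --> within (chart_img phi) (nbhs (phi x)).
Proof.
move=> px A; rewrite /within/= => /(chart_cvg px) nA.
have {}nA : \forall z \near x, chart_img phi (phi z) -> A (phi z) := nA.
change (\forall z \near x, A (phi z)); near=> z.
have /chart_imgT : chart_dom phi z by near: z; exact: chart_dom_nbhs.
by near: z.
Unshelve. all: by end_near. Qed.

(** The image is relatively open in the half-space, so near [p] it is as convex as the half-space
    itself. *)
Lemma chart_img_near phi p : chart_img phi p ->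
  \forall v \near p, half_space v -> chart_img phi v.
Proof.
have [U [Uo ->]] := chart_img_open phi; move=> [Up _].
by near=> v => hv; split=> //; near: v; exact: open_nbhs_nbhs.
Unshelve. all: by end_near. Qed.

Lemma chart_img_half phi p : chart_img phi p -> half_space p.
Proof. by have [U [_ ->]] := chart_img_open phi; case. Qed.

Lemma chart_img_inv phi p : chart_img phi p ->
  chart_dom phi (chart_inv phi p) /\ phi (chart_inv phi p) = p.
Proof. by case=> z pz <-; rewrite chart_mapK ?inE. Qed.

End charts.

(** * Short straight segments in a chart *)

Section arcs.
Context {R : realType} {n : nat} {M : topologicalType}.
Variables (S : smooth_atlas R n M) (g : riemannian_metric S).

(** These are the conditions that [curve_has_length] puts on one piece of its subdivision. *)
Definition is_arc (gamma : R -> M) (a b : R) (phi : chart R n M)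
    (c : R -> 'rV[R]_n) : Prop :=
  [/\ a < b, charts S phi, C1_curve c &
      forall s, s \in `[a, b] -> chart_dom phi (gamma s) /\ c s = phi (gamma s)].

Definition arc_length a b phi c : R :=
  \int[lebesgue_measure]_(s in `[a, b]) speed g phi c s.

Lemma speed_ge0 phi c s : 0 <= speed g phi c s.
Proof. exact: sqrtr_ge0. Qed.

(** Near [phi x] the metric is bounded and the image of the chart is a half-space, so the segment
    from [phi u] to [phi w] lifts to a curve whose speed is at most a constant times [r]. The
    starting time [a] is free so that the segment can be glued to either end of a given curve. *)
Lemma short_segment phi x (e : R) : charts S phi -> chart_dom phi x -> 0 < e ->
  \forall r \near 0^'+, forall u w, chart_dom phi u -> chart_dom phi w ->
    `|phi u - phi x| < r -> `|phi w - phi x| < r ->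
    forall a, exists gamma c, [/\ gamma a = u, gamma (a + 1) = w,
      is_arc gamma a (a + 1) phi c & arc_length a (a + 1) phi c <= e].
Proof.
move=> Sphi px e0; have ipx := chart_imgT px.
(* The added 1 leaves room for a bound near [phi x], and gives [B >= 1], whence [e ^ 2 / B <= e ^ 2]
   at the end. *)
pose B := `|g phi (phi x)| + 1.
have B1 : 1 <= B by rewrite lerDr.
have B0 : 0 < B by rewrite (lt_le_trans _ B1).
have : \forall v \near phi x,
    (half_space v -> chart_img phi v) /\ (chart_img phi v -> `|g phi v| < B).
  near=> v; split; near: v; first exact: chart_img_near.
  have /(@cvg_norm _ _ _ _ _ _) := smooth_on_cvg (gcoef_smooth g Sphi) ipx.
  by move/(@cvgr_lt _ _ _ _ _ _) => /(_ B); rewrite near_withinE;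
    apply; rewrite ltrDl.
move/nbhs_ballP => [r0 /= r00 r0P].
near=> r => u w pu pw ur wr a.
have rr0 : r <= r0 by near: r; exact: nbhs_right_le.
(* [n.+1] bounds [n] and is positive even when [n] is 0. *)
have re : n.+1%:R * (2 * r) <= e / B.
  rewrite mulrA -ler_pdivlMl ?mulr_gt0//.
  by near: r; apply: nbhs_right_le; rewrite !(mulr_gt0, invr_gt0)//.
pose v := phi w - phi u.
have vr : `|v| <= 2 * r.
  rewrite /v (_ : _ - _ = (phi w - phi x) - (phi u - phi x)); last first.
    by rewrite opprB addrA subrK.
  by rewrite (le_trans (ler_normB _ _))// mulr_natl mulr2n lerD// ltW.
pose c := fun s : R => phi u + (s - a) *: v.
(* [c s] is a convex combination of [phi u] and [phi w], and both the ball and the half-space are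
   convex. *)
have cr s : s \in `[a, a + 1] -> ball (phi x) r0 (c s) /\ half_space (c s).
  rewrite in_itv/= => /andP[a_s sa].
  have cE : c s = (1 - (s - a)) *: phi u + (s - a) *: phi w.
    by apply/rowP => i; rewrite !mxE; ring.
  split; last first.
    move=> i i0; rewrite cE !mxE addr_ge0// mulr_ge0 ?subr_ge0//.
    - by rewrite lerBlDl.
    - by have /chart_img_half := chart_imgT pu; apply.
    - by have /chart_img_half := chart_imgT pw; apply.
  rewrite -ball_normE /= distrC; apply: lt_le_trans rr0.
  have -> : c s - phi x =
      (1 - (s - a)) *: (phi u - phi x) + (s - a) *: (phi w - phi x).
    by rewrite cE; apply/rowP => i; rewrite !mxE; ring.
  apply: (le_lt_trans (ler_normD _ _)); rewrite !normrZ.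
  rewrite !ger0_norm ?subr_ge0//; last by rewrite lerBlDl.
  (* The strict inequality comes from the [w] term, except at [s = a] where that term vanishes. *)
  have [->|sa0] := eqVneq s a; first by rewrite subrr subr0 mul0r mul1r addr0.
  rewrite [ltRHS](_ : r = (1 - (s - a)) * r + (s - a) * r); last by ring.
  rewrite ler_ltD//.
    by rewrite ler_wpM2l ?(ltW ur)// subr_ge0 lerBlDl.
  by rewrite ltr_pM2l// subr_gt0 lt_neqAle eq_sym sa0.
have ci s : s \in `[a, a + 1] -> chart_img phi (c s).
  by move=> /cr[/r0P[]]; auto.
exists (chart_inv phi \o c), c.
have [cC1 c'] := C1_curve_segment (phi u) v a.
have ca : c a = phi u by rewrite /c subrr scale0r addr0.
have ca1 : c (a + 1) = phi w.
  by rewrite /c addrAC subrr add0r scale1r /v addrC subrK.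
split => /=.
- by rewrite ca chart_mapK ?inE.
- by rewrite ca1 chart_mapK ?inE.
- split=> //; first by rewrite ltrDl.
  by move=> s /ci /chart_img_inv[].
(* The parameter interval has length 1, so it suffices to bound the speed by [e]. *)
rewrite /arc_length -[leRHS]mulr1 -[in leRHS](addrK a 1) [in leRHS](addrC 1).
apply: Rintegral_le_cst; first by rewrite lerDl.
move=> s sa; rewrite speed_ge0/= /speed c' /=.
rewrite -(gtr0_norm e0) -sqrtr_sqr; apply: ler_wsqrtr.
apply: (le_trans (mulmx_quad_le _ _)).
have gB : `|g phi (c s)| <= B by have [/r0P[_ /(_ (ci _ sa))/ltW]] := cr _ sa.
have nv : n%:R * `|v| <= e / B.
  apply: le_trans re; rewrite ler_pM// ler_nat; done.
apply: (@le_trans _ _ (B * (e / B) ^+ 2)).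
  apply: ler_pM => //.
  have eB0 : 0 <= e / B by rewrite divr_ge0// ltW.
  by apply: lerXn2r => //; rewrite nnegrE ?mulr_ge0.
rewrite expr_div_n [leLHS](_ : _ = e ^+ 2 / B); last by field; rewrite gt_eqF.
by rewrite ler_pdivrMr// ler_peMr// sqr_ge0.
Unshelve. all: by end_near. Qed.

End arcs.

(** * Prolongation of curves and continuity of the distance *)

Section distance.
Context {R : realType} {n : nat} {M : topologicalType}.
Variables (S : smooth_atlas R n M) (g : riemannian_metric S).

Lemma curve_length_ge0 (gamma : R -> M) a b L :
  curve_has_length g gamma a b L -> 0 <= L.
Proof.
move=> [N [t [phi [c [_ _ _ ->]]]]]; apply: sumr_ge0 => i _.
by apply: Rintegral_ge0 => s _; exact: speed_ge0.
Qed.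

Lemma riem_dist_le_length (x y : M) (gamma : R -> M) a b L :
  gamma a = x -> gamma b = y -> curve_has_length g gamma a b L ->
  riem_dist g x y <= L.
Proof.
move=> ax by_ cL; apply: ge_inf; last by exists gamma, a, b.
by exists 0 => L' [? [? [? [_ _ /curve_length_ge0]]]].
Qed.

Lemma subdivision_ge (N : nat) (t : nat -> R) i j :
  (forall k, (k < N)%N -> t k < t k.+1) -> (i <= j)%N -> (j <= N)%N -> t i <= t j.
Proof.
move=> tS; elim: j => [|j IH]; first by rewrite leqn0 => /eqP->.
rewrite leq_eqVlt => /predU1P[->//|ij] jN.
by apply: le_trans (IH ij (ltnW jN)) (ltW (tS _ jN)).
Qed.

(** Lengths are sums over the pieces, and the arc is one more piece, with last index [N]. *)
Lemma curve_append (gamma ga : R -> M) a b L d phi c :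
  curve_has_length g gamma a b L -> gamma b = ga b -> is_arc S ga b d phi c ->
  exists2 gamma', gamma' a = gamma a /\ gamma' d = ga d &
    curve_has_length g gamma' a d (L + arc_length g b d phi c).
Proof.
move=> [N [t [ph [cs [t0 tN tcs ->]]]]] gb [bd Sphi cC1 arc].
have tS k : (k < N)%N -> t k < t k.+1 by move=> /tcs[].
have ab : a <= b by rewrite -t0 -tN; apply: (subdivision_ge tS).
exists (fun s => if s <= b then gamma s else ga s).
  by rewrite ab leNgt bd.
(* There is one more breakpoint than pieces, whence [i <= N] for the old breakpoints but [i < N] for
   the old pieces. *)
exists N.+1, (fun i => if (i <= N)%N then t i else d),
  (fun i => if (i < N)%N then ph i else phi),
  (fun i => if (i < N)%N then cs i else c); split.
- by [].
- by rewrite ltnn.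
- move=> i iN1; have [iN|Ni] := ltnP i N; last first.
    have -> : i = N by apply/eqP; rewrite eqn_leq Ni -ltnS iN1.
    rewrite leqnn tN; split=> // s; rewrite in_itv/= => /andP[bs sd].
    (* The glued curve follows [gamma] up to and including [b], so the new closed piece needs the
       agreement of [gamma] and [ga] there. *)
    case: ifPn => [sb|_]; last by apply: arc; rewrite in_itv/= bs.
    have -> : s = b by apply/eqP; rewrite eq_le sb.
    by rewrite gb; apply: arc; rewrite in_itv/= lexx ltW.
  rewrite (ltnW iN); have [tt Sp cC arcs] := tcs _ iN; split=> // s sI.
  rewrite ifT; first exact: arcs.
  move: sI; rewrite in_itv/= => /andP[_ /le_trans]; apply.
  by rewrite -tN; apply: (subdivision_ge tS).
- rewrite big_ord_recr /=.
  rewrite leqnn.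
  rewrite ltnn.
  rewrite tN.
  rewrite /arc_length; apply: (congr2 +%R _ erefl).
  apply: eq_bigr => i _.
  rewrite (ltnW (ltn_ord i)).
  by rewrite ltn_ord.
Qed.

(** Mirror image of [curve_append]: the arc takes index 0 and the old pieces are shifted by one. *)
Lemma curve_prepend (gamma ga : R -> M) a b L d phi c :
  curve_has_length g gamma a b L -> gamma a = ga a -> is_arc S ga d a phi c ->
  exists2 gamma', gamma' d = ga d /\ gamma' b = gamma b &
    curve_has_length g gamma' d b (arc_length g d a phi c + L).
Proof.
move=> [N [t [ph [cs [t0 tN tcs ->]]]]] gb [bd Sphi cC1 arc].
have tS k : (k < N)%N -> t k < t k.+1 by move=> /tcs[].
have ab : a <= b by rewrite -t0 -tN; apply: (subdivision_ge tS).
exists (fun s => if a <= s then gamma s else ga s).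
  by rewrite ab leNgt bd.
exists N.+1, (fun i => if i is j.+1 then t j else d),
  (fun i => if i is j.+1 then ph j else phi),
  (fun i => if i is j.+1 then cs j else c); split.
- by [].
- by [].
- move=> [_|i iN].
    rewrite t0; split=> // s; rewrite in_itv/= => /andP[bs sd].
    case: ifPn => [sb|_]; last by apply: arc; rewrite in_itv/= bs.
    have -> : s = a by apply/eqP; rewrite eq_le sb sd.
    by rewrite gb; apply: arc; rewrite in_itv/= lexx ltW.
  have [tt Sp cC arcs] := tcs i iN; split=> // s sI.
  rewrite ifT; first exact: arcs.
  move: sI; rewrite in_itv/= => /andP[/(le_trans _) + _]; apply.
  by rewrite -t0; apply: (subdivision_ge tS) => //; exact: ltnW.
- by rewrite big_ord_recl/= t0.
Qed.

(** The first transfer of curves compares the two infima. The second covers the default value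
    [inf set0 = 0]: if no curve joins [x] to [y], then none joins [x'] to [y'], and both distances
    are 0. *)
Lemma riem_dist_le_add (x y x' y' : M) (e : R) : 0 <= e ->
  (forall gamma a b L, gamma a = x -> gamma b = y ->
    curve_has_length g gamma a b L ->
    exists gamma' a' b', exists2 L', [/\ gamma' a' = x', gamma' b' = y' &
    curve_has_length g gamma' a' b' L'] & L' <= L + e) ->
  (forall gamma a b L, gamma a = x' -> gamma b = y' ->
    curve_has_length g gamma a b L ->
    exists gamma' a' b' L', [/\ gamma' a' = x, gamma' b' = y &
    curve_has_length g gamma' a' b' L']) ->
  riem_dist g x' y' <= riem_dist g x y + e.
Proof.
move=> e0 xy x'y'; rewrite -lerBlDr.
have [[L [ga [a [b [ax by_ cL]]]]]|/set0P/negP/negPn/eqP xy0] :=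
  pselect ([set L | exists gamma a b,
    [/\ gamma a = x, gamma b = y & curve_has_length g gamma a b L]] !=set0).
- apply: lb_le_inf; first by exists L, ga, a, b.
  move=> L' [ga' [a' [b' [ax' by' cL']]]]; rewrite lerBlDr.
  have [ga2 [a2 [b2 [L2 [? ? cL2] /(le_trans _)]]]] := xy _ _ _ _ ax' by' cL'.
  by apply; exact: riem_dist_le_length cL2.
- rewrite [X in _ <= X]/riem_dist xy0 inf0 lerBlDr add0r /riem_dist.
  rewrite (_ : mkset _ = set0) ?inf0//; rewrite -subset0.
  move=> L' [ga' [a' [b' [ax' by' cL']]]].
  have [ga2 [a2 [b2 [L2 [? ? cL2]]]]] := x'y' _ _ _ _ ax' by' cL'.
  have : set0 L2 by rewrite -xy0; exists ga2, a2, b2.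
  by [].
Qed.

(* When no curve joins [x] and [y], [riem_dist g x y] is [inf set0 = 0]; then no
   curve joins [z] and [y] either for [z] near [x]. *)
Lemma riem_dist_near (x : M) (e : R) : 0 < e ->
  \forall z \near x, forall y,
    [/\ riem_dist g x y <= riem_dist g z y + e,
        riem_dist g z y <= riem_dist g x y + e,
        riem_dist g y x <= riem_dist g y z + e &
        riem_dist g y z <= riem_dist g y x + e].
Proof.
move=> e0; have [phi Sphi px] := charts_cover S x.
have [r r0 rP] : exists2 r : R, 0 < r & forall u w,
    chart_dom phi u -> chart_dom phi w ->
    `|phi u - phi x| < r -> `|phi w - phi x| < r ->
    forall a, exists gamma c, [/\ gamma a = u, gamma (a + 1) = w,
      is_arc S gamma a (a + 1) phi c & arc_length g a (a + 1) phi c <= e].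
  near (0 : R)^'+ => r; exists r; first by [].
  by near: r; exact: short_segment.
(* Curves are prolonged at their start for the first inequality and at their end for the second.
   Exchanging [u] and [w] then gives all four. *)
have dle u w : chart_dom phi u -> chart_dom phi w ->
    `|phi u - phi x| < r -> `|phi w - phi x| < r -> forall y,
    riem_dist g u y <= riem_dist g w y + e /\
    riem_dist g y u <= riem_dist g y w + e.
  move=> pu pw ur wr y.
  have pre u' w' : chart_dom phi u' -> chart_dom phi w' ->
      `|phi u' - phi x| < r -> `|phi w' - phi x| < r ->
      forall ga a b L, ga a = w' -> ga b = y -> curve_has_length g ga a b L ->
      exists ga' a' b', exists2 L', [/\ ga' a' = u', ga' b' = y &
      curve_has_length g ga' a' b' L'] & L' <= L + e.
    move=> pu' pw' ur' wr' ga a b L gaa gab cL.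
    (* The segment runs over [[a - 1, a]], so that it ends when the given curve starts. *)
    have [s [c [sa sa1 arc le]]] := rP _ _ pu' pw' ur' wr' (a - 1).
    rewrite subrK in sa1 arc le.
    have [ga' [g1 g2] cL'] := curve_prepend cL (etrans gaa (esym sa1)) arc.
    exists ga', (a - 1), b; exists (arc_length g (a - 1) a phi c + L).
      by rewrite g1 g2 sa gab.
    by rewrite addrC lerD2l.
  have app u' w' : chart_dom phi u' -> chart_dom phi w' ->
      `|phi u' - phi x| < r -> `|phi w' - phi x| < r ->
      forall ga a b L, ga a = y -> ga b = w' -> curve_has_length g ga a b L ->
      exists ga' a' b', exists2 L', [/\ ga' a' = y, ga' b' = u' &
      curve_has_length g ga' a' b' L'] & L' <= L + e.
    move=> pu' pw' ur' wr' ga a b L gaa gab cL.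
    have [s [c [sa sa1 arc le]]] := rP _ _ pw' pu' wr' ur' b.
    have [ga' [g1 g2] cL'] := curve_append cL (etrans gab (esym sa)) arc.
    exists ga', a, (b + 1); exists (L + arc_length g b (b + 1) phi c).
      by rewrite g1 g2 sa1 gaa.
    by rewrite lerD2l.
  split; apply: riem_dist_le_add (ltW e0) _ _.
  - exact: pre.
  - move=> ga a b L ga1 ga2 cL.
    have [ga' [a' [b' [L' ? _]]]] := pre _ _ pw pu wr ur _ _ _ _ ga1 ga2 cL.
    by exists ga', a', b', L'.
  - exact: app.
  - move=> ga a b L ga1 ga2 cL.
    have [ga' [a' [b' [L' ? _]]]] := app _ _ pw pu wr ur _ _ _ _ ga1 ga2 cL.
    by exists ga', a', b', L'.
have xr : `|phi x - phi x| < r by rewrite subrr normr0.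
near=> z => y.
have pz : chart_dom phi z by near: z; exact: chart_dom_nbhs.
have zr : `|phi z - phi x| < r.
  by near: z; have /cvgr_distC_lt := chart_cvg px; apply.
have [] := dle _ _ px pz xr zr y; have [] := dle _ _ pz px zr xr y.
by split.
Unshelve. all: by end_near. Qed.

End distance.

(** * Continuity and positivity of determinants *)

(** By the Leibniz formula the determinant is a polynomial in the entries. *)
Lemma det_cvg {R : realType} {n} {T : Type} (F : set_system T) (FF : Filter F)
    (A : T -> 'M[R]_n) (B : 'M[R]_n) :
  (forall i j, A t i j @[t --> F] --> B i j) -> \det (A t) @[t --> F] --> \det B.
Proof.
move=> AB; rewrite /determinant.
apply: (@cvg_big R _ +%R 0 _ _ _ _ _ _ _ FF) => [|s _]; first exact: add_continuous.
apply: cvgM; first exact: cvg_cst.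
apply: (@cvg_big R _ *%R 1 _ _ _ _ _ _ _ FF) => [|i _]; last exact: AB.
exact: mul_continuous.
Qed.

(* Along the segment from the identity to [G] all matrices are positive definite,
   hence invertible, so the determinant keeps its sign. *)
Lemma det_gt0 {R : realType} {n} (G : 'M[R]_n) :
  (forall w : 'rV[R]_n, w != 0 -> 0 < (w *m G *m w^T) ord0 ord0) -> 0 < \det G.
Proof.
move=> G0; pose A (t : R) : 'M[R]_n := t *: G + (1 - t)%:M.
have A0 t : 0 <= t <= 1 -> \det (A t) != 0.
  move=> /andP[t0 t1]; apply/det0P => -[v v0 vA].
  have : (v *m A t *m v^T) ord0 ord0 = 0 by rewrite vA mul0mx mxE.
  rewrite /A mulmxDr mulmxDl -scalemxAr -scalemxAl mul_mx_scalar -scalemxAl.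
  rewrite !mxE => /eqP; apply/negP; rewrite gt_eqF//.
  have vv : 0 < (v *m v^T) ord0 ord0.
    rewrite mxE lt_neqAle sumr_ge0 ?andbT => [|i _]; last first.
      by rewrite mxE -expr2 sqr_ge0.
    apply: contra v0; rewrite eq_sym psumr_eq0 => [/allP vi|i _]; last first.
      by rewrite mxE -expr2 sqr_ge0.
    apply/eqP/rowP => i; have := vi i (mem_index_enum _).
    by rewrite !mxE mulf_eq0 orbb => /eqP.
  have := G0 v v0; move: vv; rewrite !mxE => vv Gv.
  (* At [t = 0] the term in [G] vanishes and the identity alone gives positivity. *)
  have [->|t00] := eqVneq t 0; first by rewrite mul0r add0r subr0 mul1r.
  rewrite ltr_pwDl//; last by rewrite mulr_ge0 ?subr_ge0// ltW.
  by rewrite mulr_gt0// lt_neqAle eq_sym t00.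
have Ac : continuous (fun t => \det (A t)).
  move=> t; apply: det_cvg => i j; rewrite /A.
  under eq_cvg do rewrite !mxE.
  rewrite !mxE; apply: cvgD; first by apply: cvgM; [exact: cvg_id|exact: cvg_cst].
  apply: cvgMn; apply: cvgB; [exact: cvg_cst|exact: cvg_id].
rewrite ltNge; apply/negP => G_le0.
(* [A 0] is the identity, of determinant 1, and [A 1] is [G]; a determinant of [G] that is at most 0
   would force a zero in between. *)
have [||t] := @IVT R (fun t => \det (A t)) 0 1 0 ler01.
- exact: continuous_subspaceT.
- rewrite /A scale1r scale0r subrr subr0 add0r det1 raddf0 addr0.
  by rewrite ge_min G_le0 orbT le_max ler01.
- by rewrite in_itv/= => /A0/eqP.
Qed.

(** * Lebesgue measure of boxes *)

(** The sides are indexed by [nat] so that removing the first coordinate is the shift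
    [fun i => I i.+1]. *)
Definition tuple_box (R : realType) n (I : nat -> set R) : set (n.-tuple R) :=
  [set t | forall i : 'I_n, I i (tnth t i)].
Arguments tuple_box {R} n I _.

Section boxes.
Context {R : realType}.

Lemma measurable_tuple_box n (I : nat -> set R) :
  (forall i, measurable (I i)) -> measurable (tuple_box n I).
Proof.
move=> mI.
rewrite (_ : tuple_box n I =
  \bigcap_(i in [set: 'I_n]) ((fun t : n.-tuple R => tnth t i) @^-1` I i)).
  apply: fin_bigcap_measurable => [|i _]; first exact: finite_finset.
  by rewrite -[X in measurable X]setTI; exact: measurable_tnth.
by apply/seteqP; split=> t /= tI i => [_|]; exact: tI.
Qed.

(** By induction on [n]: consing pulls a box back to the product of its first side and the shifted
    box. For [n = 0] the Dirac mass of the only tuple equals the empty product. *)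
Lemma lebesgue_tuple_box n (I : nat -> set R) : (forall i, measurable (I i)) ->
  lebesgue_tuple R n (tuple_box n I) = (\prod_(i < n) lebesgue_measure (I i))%E.
Proof.
elim: n I => [|n IH] I mI.
  rewrite big_ord0 /= diracE mem_set//; by case.
rewrite big_ord_recl -(IH (fun i => I i.+1))//.
rewrite -product_measure1E//; [|exact: mI|exact: measurable_tuple_box].
rewrite /= /lebesgue_tuple_step /pushforward; congr ((_ \x _) _)%E.
apply/seteqP; split=> -[x t] /=.
  move=> xt; split; first by have := xt ord0; rewrite (tnth_nth 0).
  by move=> i; have := xt (lift ord0 i); rewrite !(tnth_nth 0).
move=> [Ix tI] i; rewrite (tnth_nth 0).
case: (unliftP ord0 i) => [j ->|-> //].
by have := tI j; rewrite (tnth_nth 0).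
Qed.

Lemma lebesgue_tuple_cube n (a b : nat -> R) (r : R) :
  (forall i, b i - a i = r) -> 0 < r ->
  lebesgue_tuple R n (tuple_box n (fun i => `]a i, b i[%classic)) = (r ^+ n)%:E.
Proof.
move=> ab r0; rewrite lebesgue_tuple_box//.
transitivity (\prod_(i < n) r%:E)%E.
  apply: eq_bigr => i _; rewrite lebesgue_measure_itv/= lte_fin.
  by rewrite -subr_gt0 ab r0 -EFinD ab.
by rewrite prodEFin prodr_const card_ord.
Qed.

End boxes.

(** * Riemannian volume: finiteness, and positivity on open sets *)

Section volume.
Context {R : realType} {n : nat} {M : ptopologicalType}.
Variables (S : smooth_atlas R n M) (g : riemannian_metric S).
Variable V : {measure set (borel M) -> \bar R}.
Hypothesis V_volume : is_riemannian_volume g V.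

Lemma open_measurable_borel (U : set M) :
  open U -> measurable (U : set (borel M)).
Proof. by move=> oU; exact: sub_sigma_algebra. Qed.

(** Extends the coordinates by 0 to all of [nat], as the sides of a [tuple_box] require. *)
Definition row_nth (p : 'rV[R]_n) (i : nat) : R :=
  if insub i is Some j then p ord0 j else 0.

Lemma row_nthE (p : 'rV[R]_n) (i : 'I_n) : row_nth p i = p ord0 i.
Proof. by rewrite /row_nth valK. Qed.

Lemma row_of_tuple_ball (p : 'rV[R]_n) r (t : n.-tuple R) :
  ball p r (row_of_tuple t) ->
  tuple_box n (fun i => `](row_nth p i - r),
                         (row_nth p i + r)[%classic) t.
Proof.
case=> r0 pt i /=; rewrite in_itv/= row_nthE -ltr_distl distrC.
by have := pt ord0 i; rewrite mxE.
Qed.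

(** The cube has [p] as its lowest corner instead of its centre: coordinates only increase from [p],
    so the cube stays in the half-space even when [p] is a boundary point. *)
Lemma ball_row_of_tuple (p : 'rV[R]_n) r (t : n.-tuple R) : 0 < r ->
  tuple_box n (fun i => `]row_nth p i,
                         (row_nth p i + r)[%classic) t ->
  ball p r (row_of_tuple t) /\ (half_space p -> half_space (row_of_tuple t)).
Proof.
move=> r0 tb.
have {}tb i : p ord0 i < tnth t i < p ord0 i + r.
  by have := tb i; rewrite /= in_itv/= row_nthE.
split.
  split=> // j i; rewrite !ord1 mxE /ball/=; have /andP[lt1 lt2] := tb i.
  rewrite distrC gtr0_norm ?subr_gt0//.
  by rewrite ltrBlDl.
move=> hp i i0; rewrite mxE; have /andP[lt1 _] := tb i.
by rewrite (le_trans (hp i i0))// ltW.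
Qed.

Lemma det_gcoef_cvg phi x : charts S phi -> chart_dom phi x ->
  \det (g phi v) @[v --> within (chart_img phi) (nbhs (phi x))] -->
    \det (g phi (phi x)).
Proof.
move=> Sphi px; apply: det_cvg => i j.
apply: (@cvg_comp _ _ _ (g phi) (fun A : 'M[R]_n => A i j)).
  exact: smooth_on_cvg (gcoef_smooth g Sphi) (chart_imgT px).
exact: coord_continuous.
Qed.

Lemma chart_inv_cvg (phi : chart R n M) x : chart_dom phi x ->
  chart_inv phi v @[v --> within (chart_img phi) (nbhs (phi x))] --> x.
Proof.
move=> px; have ip := chart_imgT px.
have : chart_inv phi v @[v --> nbhs (phi x : subspace (chart_img phi))] -->
  chart_inv phi (phi x) := @chart_inv_continuous _ _ _ phi (phi x).
by rewrite chart_mapK ?inE// (nbhs_subspace_in ip).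
Qed.

(** On a small neighbourhood inside a chart the density is bounded by continuity, and the image lies
    in a cube of finite Lebesgue measure. *)
Lemma volume_locally_finite x : exists2 U : set M, open U /\ U x & (V U < +oo)%E.
Proof.
have [phi Sphi px] := charts_cover S x; have ip := chart_imgT px.
pose K := `|\det (g phi (phi x))| + 1.
have /nbhs_ballP[r /= r0 rK] : \forall v \near phi x,
    chart_img phi v -> `|\det (g phi v)| < K.
  have /(@cvg_norm _ _ _ _ _ _) := det_gcoef_cvg Sphi px.
  by move/(@cvgr_lt _ _ _ _ _ _) => /(_ K); rewrite near_withinE;
    apply; rewrite ltrDl.
have : nbhs x (chart_dom phi `&` [set z | ball (phi x) r (phi z)]).
  apply: filterI; first exact: chart_dom_nbhs.
  have /chart_cvg := px; apply; exact: nbhsx_ballx.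
rewrite nbhsE => -[U [oU Ux] UB]; exists U => //.
rewrite (V_volume Sphi (open_measurable_borel oU)); last by move=> z /UB[].
set I := fun i => `](row_nth (phi x) i - r),
                    (row_nth (phi x) i + r)[%classic.
have mI i : measurable (I i) by exact: measurable_itv.
apply: (@le_lt_trans _ _
    (\int[lebesgue_tuple R n]_(t in tuple_box n I) (cst (Num.sqrt K)%:E t))%E).
  apply: ge0_le_integral_dom => t.
  - by rewrite lee_fin sqrtr_ge0.
  - by rewrite lee_fin sqrtr_ge0.
  - move=> [z Uz zt]; have [pz /= bz] := UB _ Uz.
    rewrite zt in bz; split; first exact: row_of_tuple_ball.
    rewrite lee_fin ler_wsqrtr// (le_trans (ler_norm _))// ltW//.
    by apply: rK => //; rewrite -zt; exact: chart_imgT.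
rewrite integral_cst; last exact: measurable_tuple_box.
rewrite [X in (_ * X)%E](_ : _ = ((r + r) ^+ n)%:E); last first.
  apply: (@lebesgue_tuple_cube R n (fun i => row_nth (phi x) i - r)
    (fun i => row_nth (phi x) i + r)); last exact: addr_gt0.
  by move=> i; ring.
by rewrite -EFinM ltry.
Qed.

(** Near a point of [U] the determinant of the metric exceeds half its positive value there, and the
    image of [U] in a chart contains a small cube with that point as corner. *)
Lemma volume_open_gt0 (U : set M) : open U -> U !=set0 -> (0 < V U)%E.
Proof.
move=> oU [x Ux]; have [phi Sphi px] := charts_cover S x; have ip := chart_imgT px.
have oW : open (U `&` chart_dom phi) by apply: openI => //; exact: chart_dom_open.
apply: (@lt_le_trans _ _ (V (U `&` chart_dom phi))); last first.
  by apply: le_measure; rewrite ?inE; [exact: open_measurable_borel..|].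
pose d := \det (g phi (phi x)) / 2.
have d0 : 0 < \det (g phi (phi x)).
  by apply: det_gt0 => w w0; exact: gcoef_pos.
have /nbhs_ballP[r /= r0 rP] : \forall v \near phi x, half_space v ->
    [/\ chart_img phi v, d < \det (g phi v) & U (chart_inv phi v)].
  have h1 := chart_img_near ip.
  have h2 : \forall v \near phi x, chart_img phi v -> d < \det (g phi v).
    have /(@cvgr_gt _ _ _ _ _ _) := det_gcoef_cvg Sphi px => /(_ d).
    by rewrite near_withinE; apply; rewrite /d ltr_pdivrMr// ltr_pMr// ltr1n.
  have h3 : \forall v \near phi x, chart_img phi v -> U (chart_inv phi v).
    by have := chart_inv_cvg px; apply; exact: open_nbhs_nbhs.
  near=> v => hv.
  have iv : chart_img phi v by move: hv; near: v.
  by split=> //; move: iv; near: v.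
rewrite (V_volume Sphi (open_measurable_borel oW)); last exact: subIsetr.
set I := fun i => `]row_nth (phi x) i,
                    (row_nth (phi x) i + r)[%classic.
have mI i : measurable (I i) by exact: measurable_itv.
apply: (@lt_le_trans _ _
    (\int[lebesgue_tuple R n]_(t in tuple_box n I) (cst (Num.sqrt d)%:E t))%E).
  rewrite integral_cst; last exact: measurable_tuple_box.
  rewrite [X in (_ * X)%E](_ : _ = (r ^+ n)%:E); last first.
    apply: (@lebesgue_tuple_cube R n (row_nth (phi x))
      (fun i => row_nth (phi x) i + r)) => // i.
    by ring.
  by rewrite -EFinM lte_fin mulr_gt0 ?exprn_gt0// sqrtr_gt0 divr_gt0.
apply: ge0_le_integral_dom => t; rewrite ?lee_fin ?sqrtr_ge0//.
move=> /(ball_row_of_tuple r0)[/rP vP /(_ (chart_img_half ip))/vP[iv dv Uv]].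
split; last by rewrite ler_wsqrtr// ltW.
have [pv vK] := chart_img_inv iv.
by exists (chart_inv phi (row_of_tuple t)).
Unshelve. all: by end_near. Qed.

(** Finitely many open sets of finite volume cover [M]. Measurability is carried along the induction
    because subadditivity requires it. *)
Lemma compact_volume_finite : compact [set: M] -> (V [set: M] < +oo)%E.
Proof.
rewrite compact_cover => cM.
have [U Uo Ux] : exists2 U : M -> set M, (forall x, open (U x) /\ U x x) &
    forall x, (V (U x) < +oo)%E.
  have /choice[U UP] : forall x, exists U : set M, (open U /\ U x) /\ (V U < +oo)%E.
    by move=> x; have [U ? ?] := volume_locally_finite x; exists U.
  by exists U => x; have [] := UP x.
have [||D _ DT] := cM M setT U.
- by move=> x _; have [] := Uo x.
- by move=> x _; exists x => //; have [] := Uo x.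
move: DT; rewrite /cover bigcup_fset; move: (finmap.enum_fset D) => s DT.
have [mB VB] : measurable (\big[setU/set0]_(x <- s) U x : set (borel M)) /\
    (V (\big[setU/set0]_(x <- s) U x) < +oo)%E.
  elim/big_ind : _ => [|A B [mA VA] [mB VB]|x _].
  - by rewrite measure0.
  - split; first exact: measurableU.
    by apply: le_lt_trans (measureU2 _ mA mB) _; exact: lte_add_pinfty.
  - by split; [apply: open_measurable_borel; have [] := Uo x|exact: Ux].
by apply: le_lt_trans VB; apply: le_measure; rewrite ?inE.
Qed.

End volume.

(** * The weighted measure *)

Section weighted_volume.
Context {R : realType} {n : nat} {M : ptopologicalType}.
Variables (S : smooth_atlas R n M) (g : riemannian_metric S).
Variables (V : {measure set (borel M) -> \bar R}) (mu : M -> R).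
Hypothesis V_volume : is_riemannian_volume g V.
Hypothesis M_compact : compact [set: M].
Hypothesis mu_smooth : smooth_function S mu.
Hypothesis mu_pos : forall x, 0 < mu x.

Lemma smooth_function_continuous : continuous mu.
Proof.
move=> x; have [phi Sphi px] := charts_cover S x.
have h := @smooth_on_cvg _ _ R^o _ _ _ (mu_smooth Sphi) (chart_imgT px).
have {}h := cvg_comp _ _ (chart_cvg_img px) h.
rewrite /= chart_mapK ?inE// in h.
apply: cvg_trans h; apply: near_eq_cvg; near=> z => /=.
rewrite chart_mapK// inE; near: z; exact: chart_dom_nbhs.
Unshelve. all: by end_near. Qed.

Lemma measurable_weight : measurable_fun [set: borel M] (mu : borel M -> R).
Proof.
apply: (measurability _ (measurable_realfun.RGenOInfty.measurableE R)).
move=> _ [_ [a ->] <-].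
rewrite setTI; apply: open_measurable_borel.
move/continuousP : smooth_function_continuous; apply.
exact: interval_open.
Qed.

Lemma weight_bounded : exists K, forall x, mu x <= K.
Proof.
have : compact (mu @` [set: M]).
  apply: continuous_compact => //.
  exact/continuous_subspaceT/smooth_function_continuous.
move/(@compact_bounded _ R^o) => -[K [_ KP]]; exists (K + 1) => x.
apply: le_trans (ler_norm _) _; apply: KP; first by rewrite ltrDl.
by exists x.
Qed.

Lemma weighted_measure_finite : (weighted_measure V mu [set: M] < +oo)%E.
Proof.
have [K muK] := weight_bounded.
apply: (@le_lt_trans _ _ (\int[V]_(x in [set: borel M]) (cst K%:E x))%E).
  apply: ge0_le_integral_dom => x _; rewrite ?lee_fin ?muK//; first exact: ltW.
  exact: le_trans (ltW (mu_pos x)) (muK x).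
rewrite integral_cst; last exact: measurableT.
have VM := compact_volume_finite V_volume M_compact.
have : V [set: M] \is a fin_num by rewrite ge0_fin_numE.
by move=> /fineK <-; rewrite -EFinM ltry.
Qed.

(** By continuity the weight exceeds half its value at [x] on a nonempty open part of [U], which has
    positive volume. *)
Lemma weighted_measure_open_gt0 (U : set M) : open U -> U !=set0 ->
  (0 < weighted_measure V mu U)%E.
Proof.
move=> oU [x Ux]; pose k := mu x / 2.
have k0 : 0 < k by rewrite divr_gt0.
have oW : open (U `&` mu @^-1` `]k, +oo[).
  apply: openI => //.
  move/continuousP : smooth_function_continuous; apply.
  exact: interval_open.
have mW := open_measurable_borel oW.
apply: (@lt_le_trans _ _
  (\int[V]_(z in U `&` mu @^-1` `]k, +oo[) (cst k%:E z))%E).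
  rewrite integral_cst//; apply: mule_gt0; first by rewrite lte_fin.
  apply: (volume_open_gt0 V_volume oW); exists x; split=> //=.
  by rewrite in_itv/= andbT /k ltr_pdivrMr// ltr_pMr// ltr1n.
apply: ge0_le_integral_dom => z; rewrite ?lee_fin.
- by move=> _; exact: ltW.
- by move=> _; exact: ltW.
- by move=> [Uz]; rewrite /= in_itv/= andbT => /ltW.
Qed.

Lemma weighted_measure_lt (A U : set M) : open U -> U !=set0 -> A `<=` ~` U ->
  (weighted_measure V mu A < weighted_measure V mu [set: M])%E.
Proof.
move=> oU U0 AU; have mU := open_measurable_borel oU.
have mE : weighted_measure V mu [set: M] =
    (weighted_measure V mu U + weighted_measure V mu (~` U))%E.
  rewrite /weighted_measure -(setUv U) ge0_integral_setU//.
  - exact: measurableC.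
  - rewrite setUv; apply/measurable_realfun.measurable_EFinP.
    exact: measurable_weight.
  - by move=> x _; rewrite lee_fin ltW.
  - exact/disj_setPCl.
have fin := weighted_measure_finite.
have U_gt0 := weighted_measure_open_gt0 oU U0.
have C_ge0 : (0 <= weighted_measure V mu (~` U))%E.
  by apply: integral_ge0 => x _; rewrite lee_fin ltW.
have Cfin : (weighted_measure V mu (~` U) < +oo)%E.
  by apply: le_lt_trans fin; rewrite mE leeDr// ltW.
have lt : (weighted_measure V mu (~` U) < weighted_measure V mu [set: M])%E.
  by rewrite mE lteDr// ge0_fin_numE.
apply: le_lt_trans lt; apply: ge0_le_integral_dom => x; rewrite ?lee_fin.
- by move=> _; exact: ltW.
- by move=> _; exact: ltW.
- by move=> /AU.
Qed.

End weighted_volume.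

(** * Boundary distance functions and the closure of Q(M) *)

Section boundary.
Import ArrowAsUniformType.
Context {R : realType} {n : nat} {M : ptopologicalType}.
Variables (S : smooth_atlas R n M) (g : riemannian_metric S).

Let bd : Type := set_type (mboundary S).
Let C := continuousType bd R.

(** The topology of [C] is induced from the uniform structure on all functions, whose balls of
    radius [e] ask for distance less than [e] at every point. *)
Lemma uclosureP (A : set C) (tau : C) : uclosure A tau <->
  forall e, 0 < e -> exists2 sigma : C, A sigma & forall y, `|tau y - sigma y| < e.
Proof.
have nbhsE B : nbhs tau B <-> exists2 e : R, 0 < e &
    forall sigma : C, (forall y, `|tau y - sigma y| < e) -> B sigma.
  exact: (@nbhs_ballP R (initial_topology (id : C -> (bd -> R))) tau B).
split=> [clA e e0|clA B /nbhsE[e e0 eB]].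
  have [|sigma [As /= es]] := clA [set sigma : C | forall y, `|tau y - sigma y| < e].
    by apply/nbhsE; exists e.
  by exists sigma.
by have [sigma As es] := clA e e0; exists sigma; split=> //; exact: eB.
Qed.

Lemma riem_dist_continuousl y : continuous (fun x => riem_dist g x y).
Proof.
move=> x; apply/cvgrPdist_le => e e0; near=> z.
have [h1 h2 _ _] : [/\ riem_dist g x y <= riem_dist g z y + e,
        riem_dist g z y <= riem_dist g x y + e,
        riem_dist g y x <= riem_dist g y z + e &
        riem_dist g y z <= riem_dist g y x + e].
  by move: (y); near: z; exact: riem_dist_near.
by rewrite ler_norml lerNl opprB lerBlDl h2 lerBlDl h1.
Unshelve. all: by end_near. Qed.

Lemma riem_dist_continuousr x : continuous (riem_dist g x).
Proof.
move=> y; apply/cvgrPdist_le => e e0; near=> z.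
have [_ _ h1 h2] : [/\ riem_dist g y x <= riem_dist g z x + e,
        riem_dist g z x <= riem_dist g y x + e,
        riem_dist g x y <= riem_dist g x z + e &
        riem_dist g x z <= riem_dist g x y + e].
  by move: (x); near: z; exact: riem_dist_near.
by rewrite ler_norml lerNl opprB lerBlDl h2 lerBlDl h1.
Unshelve. all: by end_near. Qed.

Lemma bdist_continuous x : continuous (bdist g x).
Proof.
move=> y; apply: (@continuous_comp bd M R set_val (riem_dist g x)).
  exact: initial_continuous.
exact: riem_dist_continuousr.
Qed.

Variables (V : {measure set (borel M) -> \bar R}) (mu : M -> R).
Hypothesis V_volume : is_riemannian_volume g V.
Hypothesis M_compact : compact [set: M].
Hypothesis mu_smooth : smooth_function S mu.
Hypothesis mu_pos : forall x, 0 < mu x.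

Lemma uclosure_Qset_bdist (x : M) (tau : C) :
  (tau : bd -> R) = bdist g x -> uclosure (Qset g V mu) tau.
Proof.
move=> taux; apply/uclosureP => e e0.
have contB (T : topologicalType) (f : T -> R) (c : R) :
    continuous f -> continuous (fun y => f y - c).
  by move=> fc y; apply: cvgB; [exact: fc|exact: cvg_cst].
have sc := contB bd (bdist g x) (e / 2) (@bdist_continuous x).
(* The approximant is [bdist g x - e / 2], which is at distance strictly less than [e]. *)
exists (mkcts sc : C); last first.
  move=> y; rewrite taux /mkcts/= opprB addrC subrK gtr0_norm ?divr_gt0//.
  by rewrite ltr_pdivrMr// ltr_pMr// ltr1n.
(* On a neighbourhood where distances vary by at most [e / 4], a point of [Mset] would satisfy
   [riem_dist g x y <= riem_dist g x y - e / 4] for some [y]. *)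
have e20 : 0 < e / 2 / 2 by rewrite !divr_gt0.
have := riem_dist_near g x e20.
rewrite /prop_near1 nbhsE => -[U [oU Ux] UP].
apply: (@weighted_measure_lt _ _ _ _ _ _ _ V_volume M_compact mu_smooth
  mu_pos _ _ oU).
  by exists x.
move=> z [y /=]; rewrite /mkcts /bdist => zy Uz.
have [xz _ _ _] := UP z Uz (\val y).
by have := le_trans xz (lerD zy (lexx _)); lra.
Qed.

(** The sets [A e] are closed, nonempty and shrink with [e], so by compactness they have a common
    point [x]; then [tau y <= bdist g x y + e] for every [e > 0]. *)
Lemma uclosure_Qset_le_bdist (tau : C) :
  uclosure (Qset g V mu) tau -> exists x, forall y, tau y <= bdist g x y.
Proof.
move/uclosureP => clQ.
pose A (e : R) := [set x | forall y : bd, tau y - e <= bdist g x y].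
have Aclosed e : closed (A e).
  rewrite (_ : A e = \bigcap_(y in [set: bd])
    [set x | tau y - e <= riem_dist g x (\val y)]).
    apply: closed_bigI => y _.
    apply: (@preimage_closed _ _ (fun x => riem_dist g x (\val y))
      [set r | tau y - e <= r]).
      by move=> x _; exact: riem_dist_continuousl.
    exact: closed_ge.
  by apply/seteqP; split=> [x Ax y _|x Ax y]; [exact: Ax|exact: (Ax y I)].
have A0 e : 0 < e -> A e !=set0.
  move=> e0; have [sigma Qs ts] := clQ e e0.
  (* Otherwise [Mset g sigma] would be all of [M] and have full measure. Outside it [sigma] lies
     strictly below [bdist g x], and [tau - e] lies below [sigma]. *)
  have [x nx] : exists x, ~ Mset g sigma x.
    apply/existsNP => all; move: Qs; rewrite /Qset /=.
    by rewrite (_ : Mset g sigma = setT) ?ltxx//; apply/seteqP; split.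
  exists x => y; rewrite leNgt; apply/negP => lt; apply: nx; exists y.
  have := ts y; rewrite ltr_norml /bdist in lt *; move=> /andP[_ ?]; lra.
have FF : ProperFilter (filter_from [set e : R | 0 < e] A).
  apply: filter_from_proper; last exact: A0.
  apply: filter_from_filter; first by exists 1; rewrite /= ltr01.
  move=> a b /= a0 b0; exists (Num.min a b); first by rewrite /= lt_min a0.
  move=> x Ax; split=> y; apply: le_trans (Ax y); rewrite lerD2l lerN2;
    by rewrite ge_min lexx ?orbT.
have [|x [_ clx]] := M_compact FF; first by exists 1; rewrite /= ?ltr01.
exists x => y; apply/ler_addgt0Pr => e e0; rewrite -lerBlDr.
suff : A e x by apply.
(* A cluster point of the filter is adherent to each [A e], hence belongs to it. *)
apply: Aclosed => B /clx; apply; by exists e.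
Qed.

End boundary.

(** * Maximal elements of the closure *)

Unset Implicit Arguments.

Theorem theorem3 (R : realType) (n : nat) (M : ptopologicalType)
    (S : smooth_atlas R n M) (g : riemannian_metric S)
    (V : {measure set (borel M) -> \bar R}) (mu : M -> R)
    (n_ge2 : (2 <= n)%N)
    (M_hausdorff : hausdorff_space M)
    (M_compact : compact [set: M])
    (M_connected : connected [set: M])
    (bd_nonempty : mboundary S !=set0)
    (V_volume : is_riemannian_volume g V)
    (mu_smooth : smooth_function S mu)
    (mu_pos : forall x, 0 < mu x)
    (condG : forall x1 x2 : M,
        (forall y, bdist g x1 y <= bdist g x2 y) -> x1 = x2) :
  Rset g = maximal_elements (uclosure (Qset g V mu)).
Proof.
have Rcl := uclosure_Qset_bdist V_volume M_compact mu_smooth mu_pos.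
have clR := uclosure_Qset_le_bdist M_compact (g := g) (V := V) (mu := mu).
apply/seteqP; split=> tau.
  move=> [x taux]; split; first exact: Rcl taux.
  move=> sigma /clR[z sz] ts; apply/continuousEP => y.
  (* Here [bdist g x = tau <= sigma <= bdist g z]; once [x = z], [sigma] is squeezed between equal
     functions. *)
  have xz : x = z by apply: condG => y'; rewrite -taux (le_trans (ts y')).
  by apply/eqP; rewrite eq_le ts andbT taux xz sz.
move=> [/clR[x tx] tau_max]; exists x.
(* Maximality compares elements of the function space, so the distance function is bundled with its
   continuity; it lies in the closure and above [tau]. *)
pose rx : continuousType _ _ := mkcts (@bdist_continuous _ _ _ _ g x).
suff <- : rx = tau by [].
apply: tau_max; last exact: tx.
exact: Rcl.
Qed.
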